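(* Let $\mathcal{B}$ be the (infinite) set of all full binary trees, and let $$H(x,q) := \sum_{T\in\mathcal{B}} x^{V(T)} q^{J(T)},$$ a formal power series in $x$ whose coefficients are polynomials in $q$. Then $$ H(x,q)=-\frac{-q x +\sqrt{q^{2} x^{2}-2 q x^{2}-2 q x +x^{2}-2 x +1}+x -1}{2 q x}, $$ where the square root denotes the formal power series square root with constant term $1$ (the numerator is then divisible by $2qx$).
   Context: A full binary tree is an unlabeled ordered tree defined recursively: it is either the single-vertex tree, denoted $\cdot$, or a pair $T=[T_L,T_R]$ where $T_L$ (left subtree) and $T_R$ (right subtree) are full binary trees. The number of internal vertices $V(T)$ is defined by $V(\cdot)=0$, $V([T_L,T_R])=V(T_L)+V(T_R)+1$. The number of jumps $J(T)$ is defined by $J(\cdot)=0$ and $J([T_L,T_R])=J(T_R)$ if $T_L=\cdot$, while $J([T_L,T_R])=J(T_L)+J(T_R)+1$ if $T_L\neq \cdot$. *)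

(* Defs.v *)
From HB Require Import structures.
From mathcomp Require Import all_boot all_algebra.
From mathcomp Require Import boolp classical_sets functions cardinality fsbigop.

Set Implicit Arguments.
Unset Strict Implicit.
Unset Printing Implicit Defensive.

Import GRing.Theory.
Local Open Scope ring_scope.

(* A record rather than an alias of [nat -> R], so as not to inherit the
   pointwise product of functions. *)
Record fps (R : Type) := FPS { fps_coef : nat -> R }.

HB.instance Definition _ (R : Type) := gen_eqMixin (fps R).
HB.instance Definition _ (R : Type) := gen_choiceMixin (fps R).

Lemma fps_ext (R : Type) (f g : fps R) :
  (forall n, fps_coef f n = fps_coef g n) -> f = g.
Proof. by case: f g => [f] [g] /= /funext ->. Qed.

Section Zmodule.
Variable R : zmodType.
Implicit Types f g : fps R.

Definition fps_zero : fps R := FPS (fun=> 0).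
Definition fps_opp f := FPS (fun n => - fps_coef f n).
Definition fps_add f g := FPS (fun n => fps_coef f n + fps_coef g n).

Fact fps_addA : associative fps_add.
Proof. by move=> f g h; apply: fps_ext => n /=; rewrite addrA. Qed.
Fact fps_addC : commutative fps_add.
Proof. by move=> f g; apply: fps_ext => n /=; rewrite addrC. Qed.
Fact fps_add0 : left_id fps_zero fps_add.
Proof. by move=> f; apply: fps_ext => n /=; rewrite add0r. Qed.
Fact fps_addN : left_inverse fps_zero fps_opp fps_add.
Proof. by move=> f; apply: fps_ext => n /=; rewrite addNr. Qed.

HB.instance Definition _ :=
  GRing.isZmodule.Build (fps R) fps_addA fps_addC fps_add0 fps_addN.
End Zmodule.

Section ComRing.
Variable R : comNzRingType.
Implicit Types f g h : fps R.

Definition fpsC (c : R) : fps R := FPS (fun n => if n is 0 then c else 0).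
Definition fpsX : fps R := FPS (fun n => (n == 1)%:R).

Definition fps_mul f g : fps R :=
  FPS (fun n => \sum_(i < n.+1) fps_coef f i * fps_coef g (n - i)).

Let trunc n f := \poly_(i < n.+1) fps_coef f i.

Let coef_fps_mul n m f g : (m <= n)%N ->
  fps_coef (fps_mul f g) m = (trunc n f * trunc n g)`_m.
Proof.
move=> lemn; rewrite coefM /=; apply: eq_bigr => -[i /= ltim] _.
rewrite ltnS in ltim; rewrite !coef_poly !ltnS.
by rewrite (leq_trans ltim lemn) (leq_trans (leq_subr _ _) lemn).
Qed.

Fact fps_mulC : commutative fps_mul.
Proof.
by move=> f g; apply: fps_ext => n; rewrite !(coef_fps_mul _ _ (leqnn n)) mulrC.
Qed.

Fact fps_mulA : associative fps_mul.
Proof.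
move=> f g h; apply: fps_ext => n.
transitivity (trunc n f * trunc n g * trunc n h)`_n.
  rewrite -mulrA coefM /=; apply: eq_bigr => -[i /= ltin] _.
  by rewrite coef_poly ltin; congr (_ * _); apply: coef_fps_mul; apply: leq_subr.
rewrite coefM /=; apply: eq_bigr => -[i /= ltin] _.
by rewrite -(@coef_fps_mul n) // [in LHS]coef_poly ltnS leq_subr.
Qed.

Fact fps_mul1 : left_id (fpsC 1) fps_mul.
Proof.
move=> f; apply: fps_ext => n /=.
by rewrite big_ord_recl /= mul1r subn0 big1 ?addr0 // => i _; rewrite mul0r.
Qed.

Fact fps_mulDl : left_distributive fps_mul +%R.
Proof.
move=> f g h; apply: fps_ext => n /=; rewrite -big_split /=.
by apply: eq_bigr => i _; rewrite mulrDl.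
Qed.

Fact fps_oner_neq0 : fpsC 1 != 0.
Proof.
by apply/eqP => /(congr1 (fun f => fps_coef f 0)) /= /eqP; rewrite oner_eq0.
Qed.

HB.instance Definition _ := GRing.Zmodule_isComNzRing.Build (fps R)
  fps_mulA fps_mulC fps_mul1 fps_mulDl fps_oner_neq0.

Definition fps_unit : {pred fps R} := fun f => `[< exists g, g * f = 1 >].

Definition fps_inv f : fps R :=
  if pselect (exists g, g * f = 1) is left e then sval (cid e) else f.

Fact fps_mulVf : {in fps_unit, left_inverse 1 fps_inv *%R}.
Proof.
move=> f /asboolP fU; rewrite /fps_inv; case: pselect => // e.
exact: svalP (cid e).
Qed.

Fact fps_unitPl f g : g * f = 1 -> fps_unit f.
Proof. by move=> gf1; apply/asboolP; exists g. Qed.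

Fact fps_inv_out : {in [predC fps_unit], fps_inv =1 id}.
Proof.
by move=> f /asboolPn fNU; rewrite /fps_inv; case: pselect.
Qed.

HB.instance Definition _ := GRing.ComNzRing_hasMulInverse.Build (fps R)
  fps_mulVf fps_unitPl fps_inv_out.
End ComRing.

Arguments fpsX {R}.

Section Idomain.
Variable R : idomainType.
Implicit Types f g : fps R.

Let fps_val f : f != 0 ->
  exists2 n, fps_coef f n != 0 & forall i, (i < n)%N -> fps_coef f i = 0.
Proof.
move=> f0; have exf : exists n, fps_coef f n != 0.
  apply: contrapT => nf; move/eqP: f0; apply; apply: fps_ext => n /=.
  by apply/eqP; apply: contrapT => /negP fn; apply: nf; exists n.
case: (ex_minnP exf) => n fn nmin; exists n => // i ltin.
apply/eqP; apply: contraLR ltin => /nmin; by rewrite -leqNgt.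
Qed.

Fact fps_idomain f g : f * g = 0 -> (f == 0) || (g == 0).
Proof.
move=> fg0; apply/norP => -[/fps_val [m fm mmin] /fps_val [n gn nmin]].
move/(congr1 (fun f => fps_coef f (m + n)%N)): fg0 => /=.
have ltm : (m < (m + n).+1)%N by rewrite ltnS leq_addr.
rewrite (bigD1 (Ordinal ltm)) //= addKn big1 ?addr0.
  by move/eqP; rewrite mulf_eq0 (negPf fm) (negPf gn).
move=> i; rewrite -val_eqE /= neq_ltn => /orP [ltim|ltmi].
  by rewrite mmin ?mul0r.
have [lein|ltni] := leqP i (m + n); last by have := ltn_ord i; rewrite ltnS leqNgt ltni.
by rewrite [X in _ * X]nmin ?mulr0 // ltn_subLR // ltn_add2r.
Qed.

HB.instance Definition _ :=
  GRing.ComUnitRing_isIntegral.Build (fps R) fps_idomain.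
End Idomain.

Inductive bintree : Type :=
  | Leaf
  | Node of bintree & bintree.

HB.instance Definition _ := gen_eqMixin bintree.
HB.instance Definition _ := gen_choiceMixin bintree.

Fixpoint internal (T : bintree) : nat :=
  match T with
  | Leaf => 0
  | Node L R => internal L + internal R + 1
  end.

Fixpoint jumps (T : bintree) : nat :=
  match T with
  | Leaf => 0
  | Node Leaf R => jumps R
  | Node L R => jumps L + jumps R + 1
  end.

(* The sum of an infinite family of power series, taken coefficientwise. It is
   meaningful for a summable family, i.e. when for each [n] only finitely many
   [F i] have a nonzero coefficient of degree [n]: otherwise the sum
   [\sum_(i \in _)] defaults to 0. *)
Definition fps_sum (R : zmodType) (I : choiceType) (F : I -> fps R) : fps R :=
  FPS (fun n => \sum_(i \in [set: I]%classic) fps_coef (F i) n).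

Definition jump_term (T : bintree) : fps {poly rat} :=
  fpsX ^+ internal T * fpsC 'X ^+ jumps T.

Definition jump_gf : fps {poly rat} := fps_sum jump_term.

Lemma finite_internal n : finite_set [set T | internal T = n]%classic.
Proof.
have [m] := ubnP n; elim: m n => // m IH n ltnm.
pose S k := [set T | internal T = k]%classic.
have finS k : (k < n)%N -> finite_set (S k).
  by move=> ltkn; apply: IH; apply: leq_trans ltkn _.
pose U := (\bigcup_(k in `I_n) S k)%classic.
have finU : finite_set U by apply: bigcup_finite => [|k /finS //]; exact: finite_II.
apply: (@sub_finite_set _ _
  ([set Leaf] `|` (fun p => Node p.1 p.2) @` (U `*` U))%classic).
  case=> [|L R] /= def_n; first by left.
  right; exists (L, R) => //=; split.
    by exists (internal L) => //=; rewrite -def_n addn1 ltnS leq_addr.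
  by exists (internal R) => //=; rewrite -def_n addn1 ltnS leq_addl.
by rewrite finite_setU; split=> //; apply: finite_image; apply: finite_setX.
Qed.

Lemma coef_fpsCM (R : comNzRingType) (c : R) (f : fps R) n :
  fps_coef (fpsC c * f) n = c * fps_coef f n.
Proof.
rewrite /= big_ord_recl /= subn0 big1 ?addr0 // => i _; exact: mul0r.
Qed.

Lemma fpsC_exp (R : comNzRingType) (c : R) k : fpsC c ^+ k = fpsC (c ^+ k).
Proof.
elim: k => [//|k IH]; rewrite !exprS IH; apply: fps_ext => n.
by rewrite coef_fpsCM; case: n => [|n] //=; rewrite mulr0.
Qed.

Lemma coef_fpsXn (R : comNzRingType) k n :
  fps_coef (fpsX ^+ k : fps R) n = (n == k)%:R.
Proof.
elim: k n => [|k IH] n; first by case: n.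
rewrite exprS /=; case: n => [|n].
  by rewrite big_ord_recl big_ord0 /= mul0r addr0.
rewrite !big_ord_recl /= mul0r add0r mul1r subSS subn0 IH big1 ?addr0 ?eqSS //.
by move=> i _; rewrite mul0r.
Qed.

Lemma coef_jump_term T n :
  fps_coef (jump_term T) n = if n == internal T then 'X^(jumps T) else 0.
Proof.
rewrite /jump_term fpsC_exp mulrC coef_fpsCM coef_fpsXn.
by case: eqP => _; rewrite ?mulr1 ?mulr0.
Qed.

(* The family is summable, so [jump_gf] is the intended series. *)
Lemma jump_term_summable n :
  finite_set [set T | fps_coef (jump_term T) n != 0]%classic.
Proof.
apply: sub_finite_set (finite_internal n) => T.
by rewrite /mkset coef_jump_term; case: (n =P internal T) => // _; rewrite eqxx.
Qed.

Definition is_sqrt1 (R : comNzRingType) (f s : fps R) : Prop :=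
  fps_coef s 0 = 1 /\ s ^+ 2 = f.

(* Main.v *)
Require Import Defs.
From mathcomp Require Import all_boot all_algebra.
From mathcomp Require Import boolp classical_sets cardinality fsbigop ring.

(* Splitting a tree [L, R] at its root gives H = 1 + x (1 + q (H - 1)) H, the
   left subtree contributing a factor q exactly when it is not the leaf. Hence
   q x H^2 - (1 - x + q x) H + 1 = 0, so that S = 1 - x + q x - 2 q x H is a
   square root of the discriminant, with constant term 1; it is the only one
   because fps {poly rat} is a domain where 2 != 0. *)

Import GRing.Theory FracField.
Local Open Scope ring_scope.

Lemma is_sqrt1_unique (R : idomainType) (f s : fps R) :
  (2 : R) != 0 -> is_sqrt1 f s -> unique (is_sqrt1 f) s.
Proof.
move=> two_neq0 [s0 s2]; split=> // t [t0 t2].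
have : (s - t) * (s + t) = 0 by rewrite -subr_sqr s2 t2 subrr.
move=> /eqP; rewrite mulf_eq0 subr_eq0 => /orP[/eqP//|/eqP].
(* The case [s + t = 0] is excluded by constant terms: it would give [1 + 1 = 0]. *)
move=> /(congr1 (fun f => fps_coef f 0)) /=.
by rewrite s0 t0 => /eqP; rewrite (negPf two_neq0).
Qed.

Lemma fpsX_neq0 (R : comNzRingType) : (fpsX : fps R) != 0.
Proof.
by apply/eqP => /(congr1 (fun f => fps_coef f 1)) /= /eqP; rewrite oner_eq0.
Qed.

Lemma fpsC_eq0 (R : comNzRingType) (c : R) : (fpsC c == 0) = (c == 0).
Proof.
apply/eqP/eqP => [/(congr1 (fun f => fps_coef f 0))//|->].
by apply: fps_ext; case.
Qed.

Lemma coef0_fpsXM (R : comNzRingType) (f : fps R) : fps_coef (fpsX * f) 0 = 0.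
Proof. by rewrite /= big_ord1 mul0r. Qed.

Lemma coefS_fpsXM (R : comNzRingType) (f : fps R) n :
  fps_coef (fpsX * f) n.+1 = fps_coef f n.
Proof.
rewrite /= !big_ord_recl /= mul0r add0r mul1r subSS subn0 big1 ?addr0 //.
by move=> i _; rewrite mul0r.
Qed.

Local Open Scope classical_set_scope.

(** After exchanging the two sums, each [i] survives only at the index [k = h i], which the bound
    [m] makes available. *)
Lemma fsbig_partition_ord (R : nmodType) (I : choiceType) (A : set I)
    (h : I -> nat) (F : I -> R) m :
  finite_set A -> (forall i, A i -> (h i < m)%N) ->
  \sum_(i \in A) F i = \sum_(k < m) \sum_(i \in A `&` [set i | h i = k]) F i.
Proof.
move=> finA ltm.
under [RHS]eq_bigr do rewrite fsbig_mkcondr fsbig_finite//.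
rewrite exchange_big fsbig_finite //=; apply: eq_big_seq => i.
rewrite in_fset_set // inE => /ltm lthm.
rewrite (bigD1 (Ordinal lthm)) //= mem_set // big1 ?addr0 // => k.
rewrite -val_eqE /= => /eqP neqk.
by rewrite memNset // => /= /esym.
Qed.

Definition size_trees n : set bintree := [set T | internal T = n].

Definition size_tree_pairs n : set (bintree * bintree) :=
  [set p | (internal p.1 + internal p.2)%N = n].

Lemma Node_inj : injective (fun p : bintree * bintree => Node p.1 p.2).
Proof. by move=> [L R] [L' R'] [-> ->]. Qed.

Lemma size_trees0 : size_trees 0 = [set Leaf].
Proof.
by apply/seteqP; split=> [[|L R]|_ ->] //=; rewrite /size_trees /= addn1.
Qed.

Lemma size_treesS n :
  size_trees n.+1 = (fun p => Node p.1 p.2) @` size_tree_pairs n.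
Proof.
rewrite /size_trees /size_tree_pairs;
apply/seteqP; split=> [[|L R] //=|T /= [p <- <-]].
  by rewrite addn1 => -[def_n]; exists (L, R).
by rewrite /= addn1.
Qed.

(** [Node] embeds these pairs injectively into the finite set of trees of size [n.+1]. *)
Lemma finite_size_tree_pairs n : finite_set (size_tree_pairs n).
Proof.
apply: sub_finite_set (finite_preimage (B := size_trees n.+1)
    (in2W Node_inj) (finite_internal _)) => p.
by rewrite /size_tree_pairs /size_trees /= addn1 => ->.
Qed.

(** Grouping pairs by the size of the left component gives a Cauchy product, in the very shape used
    by [fps_mul]. *)
Lemma fsum_size_tree_pairs (R : idomainType) (u v : bintree -> R) n :
  \sum_(p \in size_tree_pairs n) u p.1 * v p.2 =
  \sum_(i < n.+1) (\sum_(T \in size_trees i) u T)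
                  * (\sum_(T \in size_trees (n - i)) v T).
Proof.
rewrite (@fsbig_partition_ord _ _ _ (fun p => internal p.1) _ n.+1).
- apply: eq_bigr => -[i /= ltin] _; rewrite mulr_fsuml.
  under [RHS]eq_fsbigr do rewrite mulr_fsumr.
  rewrite (pair_fsbig _ (fun L R => u L * v R)); try exact: finite_internal.
  apply: eq_fsbigl; rewrite /size_tree_pairs /size_trees.
  apply/seteqP; split=> -[L T] /= [].
    by move=> <- <-; rewrite addKn.
  by move=> -> ->; rewrite subnKC.
- exact: finite_size_tree_pairs.
- by move=> p <-; rewrite ltnS leq_addr.
Qed.

Lemma coef_jump_gf n :
  fps_coef jump_gf n = \sum_(T \in size_trees n) ('X^(jumps T) : {poly rat}).
Proof.
rewrite [RHS]fsbig_mkcond; apply: eq_fsbigr => T _.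
rewrite coef_jump_term /functions.patch; congr (if _ then _ else _).
by apply/eqP/idP => [->|]; rewrite inE.
Qed.

(** The factor that a left subtree contributes to the weight of its parent; the extra ['X] records
    the jump at the parent. *)
Definition left_weight (T : bintree) : {poly rat} :=
  if T is Leaf then 1 else 'X * 'X^(jumps T).

Lemma exp_jumps_Node (L R : bintree) :
  'X^(jumps (Node L R)) = left_weight L * 'X^(jumps R).
Proof.
case: L => [|L1 L2]; first by rewrite mul1r.
by rewrite /left_weight -exprS -exprD /= addn1 addSn.
Qed.

(** The leaf is the only tree of size 0, so the extra ['X] affects exactly the positive degrees,
    that is, [jump_gf - 1]. *)
Lemma fsum_left_weight n :
  \sum_(T \in size_trees n) left_weight T
    = fps_coef (1 + fpsC 'X * (jump_gf - 1)) n.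
Proof.
transitivity (fps_coef 1 n
                + 'X * (fps_coef jump_gf n - fps_coef (1 : fps {poly rat}) n)).
  rewrite coef_jump_gf; case: n => [|n] /=.
    by rewrite size_trees0 !fsbig_set1 subrr mulr0 addr0.
  rewrite subr0 add0r mulr_fsumr; apply: eq_fsbigr => -[|L R] //.
  by rewrite inE.
by congr (_ + _); rewrite coef_fpsCM.
Qed.

Lemma jump_gf_eq :
  jump_gf = 1 + fpsX * ((1 + fpsC 'X * (jump_gf - 1)) * jump_gf).
Proof.
apply: fps_ext => -[|n].
  (* Coefficients of a sum are sums of coefficients by conversion; this form exposes the product by
     [fpsX] to rewriting. *)
  transitivity (1 + fps_coef
      (fpsX * ((1 + fpsC 'X * (jump_gf - 1)) * jump_gf)) 0); last by [].
  by rewrite coef0_fpsXM addr0 coef_jump_gf size_trees0 fsbig_set1.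
transitivity (0 + fps_coef
    (fpsX * ((1 + fpsC 'X * (jump_gf - 1)) * jump_gf)) n.+1); last by [].
rewrite coefS_fpsXM add0r coef_jump_gf size_treesS.
rewrite fsbig_image; last by move=> p p' _ _; apply: Node_inj.
under eq_fsbigr do rewrite exp_jumps_Node.
(* The resulting convolution is, by definition of the product, the coefficient of degree [n] on the
   right. *)
rewrite (fsum_size_tree_pairs _ left_weight (fun T => 'X^(jumps T))).
by apply: eq_bigr => i _; rewrite fsum_left_weight -coef_jump_gf.
Qed.

Local Close Scope classical_set_scope.

Theorem theorem3 :
  let x : fps {poly rat} := fpsX in
  let q : fps {poly rat} := fpsC 'X in
  exists S : fps {poly rat},
    [/\ unique (is_sqrt1 (q ^+ 2 * x ^+ 2 - 2 * q * x ^+ 2 - 2 * q * x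
                          + x ^+ 2 - 2 * x + 1)) S,
        exists G : fps {poly rat}, - q * x + S + x - 1 = 2 * q * x * G
      & tofrac jump_gf
        = - (tofrac (- q * x + S + x - 1) / tofrac (2 * q * x))
          :> {fraction fps {poly rat}}].
Proof.
(* [S] is the closed form solved for the root; writing it as [1 + x * _] makes its constant term
   evident. *)
move=> x q; pose H := jump_gf; pose S := 1 + x * (q - 1 - 2 * q * H).
have two_neq0 : (2 : {poly rat}) != 0 by rewrite -polyC_natr polyC_eq0.
have den_neq0 : 2 * q * x != 0.
  rewrite !mulf_neq0 ?fpsX_neq0 //; last by rewrite fpsC_eq0 polyX_eq0.
  apply/eqP => /(congr1 (fun f => fps_coef f 0)) /eqP.
  by rewrite (negPf two_neq0).
have numE : - q * x + S + x - 1 = 2 * q * x * (- H) by rewrite /S; ring.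
exists S; split; last 1 first.
- by rewrite numE tofracM mulrAC divff ?tofrac_eq0 // mul1r tofracN opprK.
- apply: is_sqrt1_unique => //; split.
    transitivity (1 + fps_coef (x * (q - 1 - 2 * q * H)) 0); first by [].
    by rewrite coef0_fpsXM addr0.
  have HE : H = 1 + x * ((1 + q * (H - 1)) * H) := jump_gf_eq.
  apply/eqP; rewrite -subr_eq0; apply/eqP.
  (* Completing the square: [S ^+ 2] minus the discriminant is [4 * q * x] times the defect in the
     functional equation [HE]. *)
  transitivity (4 * q * x * ((1 + x * ((1 + q * (H - 1)) * H)) - H)).
    by rewrite /S; ring.
  by rewrite -HE subrr mulr0.
- by exists (- H).
Qed.
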